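(* Let $K$ be a number field of degree $D$ (i.e. $[K:\mathbb{Q}]=D$) and let $\alpha\in K$ be a periodic point of $f(x)=x^2-2$ with minimal period $n$. Then $n\mid D$. In particular, $f^{(D)}(\alpha)=\alpha$.
   Context: A number field is a finite field extension of $\mathbb{Q}$. $\mathbb{N}$ denotes the positive integers. For a map $g$ from a set $S$ to itself and $k\in\mathbb{N}$, $g^{(k)}$ denotes the $k$-fold composition of $g$ with itself. A point $P\in S$ is periodic with respect to $g$ if $g^{(n)}(P)=P$ for some $n\in\mathbb{N}$, and the smallest such $n$ is called the minimal period of $P$. *)

(* Defs.v *)
From mathcomp Require Import all_boot all_order all_algebra all_field.

Set Implicit Arguments.
Unset Strict Implicit.
Unset Printing Implicit Defensive.

Import GRing.Theory.
Local Open Scope ring_scope.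

Definition periodic_point (S : Type) (g : S -> S) (P : S) : Prop :=
  exists n : nat, (0 < n)%N /\ iter n g P = P.

Definition minimal_period (S : Type) (g : S -> S) (P : S) (n : nat) : Prop :=
  [/\ (0 < n)%N,
      iter n g P = P
    & forall m : nat, (0 < m)%N -> iter m g P = P -> (n <= m)%N].

Definition sq_minus_two (K : pzRingType) (x : K) : K := x ^+ 2 - 2%:R.

(* Main.v *)
(** Write [alpha = z + 1/z]; then [f^k alpha = z^(2^k) + z^-(2^k)], so periodicity
    forces [z] to be a root of unity of odd order, and the automorphism
    [z |-> z^2] of the cyclotomic field sends [alpha] to [f alpha]. Hence [f] maps
    conjugates of [alpha] to conjugates of [alpha]. Being periodic with minimal
    period [n] is an algebraic condition over the rationals, so all conjugates
    have minimal period [n]: they split into [f]-cycles of length [n], and [n]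
    divides their number, which is the degree of [Q(alpha)]. *)
Require Import Defs.
From mathcomp Require Import all_boot all_order all_algebra all_field.
From mathcomp Require Import ring.

Set Implicit Arguments.
Unset Strict Implicit.
Unset Printing Implicit Defensive.

Import GRing.Theory.
Local Open Scope ring_scope.

(** An irreducible [q] that does not divide [p] is coprime to it, and a Bezout relation survives
    [h], which excludes a common root. *)
Lemma root_map_irreducible (F L : fieldType) (h : {rmorphism F -> L})
    (q p : {poly F}) (x : L) :
  irreducible_poly q -> root (map_poly h q) x ->
  root (map_poly h p) x = (q %| p).
Proof.
move=> irr_q qx; apply/idP/idP => [px|q_dv_p].
  apply: contraLR px => /negbTE q_ndv_p.
  have co_qp : coprimep (map_poly h q) (map_poly h p).
    by rewrite coprimep_map irreducible_poly_coprime ?q_ndv_p.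
  exact: coprimep_root co_qp qx.
by move: qx; rewrite -!dvdp_XsubCl => /dvdp_trans; apply; rewrite dvdp_map.
Qed.

(** Descending from [K] to [F] frees the minimal polynomial from [K], so that its roots can also be
    taken in [algC]. *)
Lemma irreducible_minPoly (F : fieldType) (K : fieldExtType F) (x : K)
    (q : {poly F}) :
  minPoly 1 x = map_poly (in_alg K) q -> irreducible_poly q.
Proof.
move=> def_q; have sz_q : size q = (adjoin_degree 1 x).+1.
  by rewrite -(size_map_poly (in_alg K)) -def_q size_minPoly.
split=> [|p p_neq1 p_dv_q]; first by rewrite sz_q ltnS lt0n.
have := @minPoly_irr _ K 1%AS x (map_poly (in_alg K) p).
rewrite def_q dvdp_map p_dv_q => /(_ _ isT).
have -> : (map_poly (in_alg K) p) \is a polyOver 1%VS by apply/polyOver1P; exists p.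
move=> /(_ isT) /orP[]; first by rewrite eqp_map.
by rewrite -size_poly_eq1 size_map_poly (negPf p_neq1).
Qed.

Lemma rmorph_sq_minus_two (R S : pzRingType) (u : {rmorphism R -> S}) (x : R) :
  u (sq_minus_two x) = sq_minus_two (u x).
Proof. by rewrite /sq_minus_two rmorphB rmorphXn rmorph_nat. Qed.

Lemma horner_iter_sq_minus_two (F L : fieldType) (h : {rmorphism F -> L})
    (k : nat) (x : L) :
  (map_poly h (iter k (@sq_minus_two _) 'X)).[x] = iter k (@sq_minus_two L) x.
Proof.
elim: k => [|k IHk] /=; first by rewrite map_polyX hornerX.
by rewrite rmorph_sq_minus_two -IHk /sq_minus_two !hornerE.
Qed.

(** Being fixed by the [k]-th iterate means being a root of the polynomial [p] over [F]. At any root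
    of [q], in any extension, this amounts to [q %| p]. *)
Lemma iter_sq_minus_two_root (F L L' : fieldType) (h : {rmorphism F -> L})
    (h' : {rmorphism F -> L'}) (q : {poly F}) (x : L) (y : L') (k : nat) :
    irreducible_poly q -> root (map_poly h q) x -> root (map_poly h' q) y ->
  iter k (@sq_minus_two L) x = x <-> iter k (@sq_minus_two L') y = y.
Proof.
move=> irr_q qx qy; pose p : {poly F} := iter k (@sq_minus_two _) 'X - 'X.
have rootE (M : fieldType) (g : {rmorphism F -> M}) (z : M) :
    root (map_poly g p) z = (iter k (@sq_minus_two M) z == z).
  by rewrite /root rmorphB /= map_polyX hornerD hornerN hornerX
             horner_iter_sq_minus_two subr_eq0.
apply: (iff_trans (rwP eqP)); apply: iff_sym; apply: (iff_trans (rwP eqP)).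
by rewrite -(rootE L h x) -(rootE L' h' y) (root_map_irreducible p irr_q qx)
           (root_map_irreducible p irr_q qy).
Qed.

Lemma iter_sq_minus_two_addV (F : fieldType) (z : F) (k : nat) : z != 0 ->
  iter k (@sq_minus_two F) (z + z^-1) = z ^+ (2 ^ k) + z ^- (2 ^ k).
Proof.
move=> z_neq0; elim: k => [|k IHk] //=; rewrite IHk expnSr !exprM /sq_minus_two.
by field; rewrite expf_neq0.
Qed.

Lemma periodic_sq_minus_two_aut (b : algC) (k : nat) :
    (0 < k)%N -> iter k (@sq_minus_two algC) b = b ->
  exists u : {rmorphism algC -> algC}, u b = sq_minus_two b.
Proof.
move=> k_gt0 b_per.
(* The coefficients encode [z ^+ 2 = b * z - 1], whose two roots [z] and [b - z] are mutually
   inverse. *)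
have [z] := @solve_monicpoly algC 2 (nth 0 [:: -1; b]) isT.
rewrite !big_ord_recl big_ord0 /= expr0 expr1 mulr1 addr0 => z2.
have zw : z * (b - z) = 1 by ring: z2.
have z_neq0 : z != 0.
  by apply: contra_eq_neq zw => ->; rewrite mul0r eq_sym oner_eq0.
have def_b : b = z + z^-1 by rewrite -[z^-1]mulr1 -zw mulKf // addrC subrK.
have [N [N_odd zN]] : exists N, odd N /\ z ^+ N = 1.
  have odd2k : odd (2 ^ k).-1.
    by rewrite -subn1 oddB ?expn_gt0 // oddX -[k]prednK.
  have def2k : (2 ^ k = (2 ^ k).-1.+1)%N by rewrite prednK ?expn_gt0.
  set w := z ^+ (2 ^ k).
  have w_neq0 : w != 0 by rewrite expf_neq0.
  (* The value [w + w^-1] determines [w] up to inversion, so [w] is [z] or [z^-1], and [z] is killed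
     by one of the odd exponents [2 ^ k - 1] and [2 ^ k + 1]. *)
  have /eqP : (w - z) * (w * z - 1) = 0.
    have: w + w^-1 = z + z^-1 by rewrite -iter_sq_minus_two_addV // -def_b.
    move/(congr1 (fun t => t * (w * z))).
    have -> : (w + w^-1) * (w * z) = w ^+ 2 * z + z by field.
    have -> : (z + z^-1) * (w * z) = w * z ^+ 2 + w by field.
    move=> /eqP; rewrite -subr_eq0 => /eqP <-; ring.
  rewrite mulf_eq0 !subr_eq0 /w def2k => /orP[] /eqP E.
    exists (2 ^ k).-1; split=> //; apply: (mulIf z_neq0).
    by rewrite -exprSr E mul1r.
  exists (2 ^ k).-1.+2; split; first by rewrite /= odd2k.
  by rewrite exprSr.
(* As [N] is odd, squaring permutes the [N]-th roots of unity and is induced by a field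
   automorphism. *)
have [u Du] : {u : {rmorphism algC -> algC} | forall t, t ^+ N = 1 -> u t = t ^+ 2}.
  by apply: Qn_aut_exists; rewrite coprime2n.
exists u; rewrite def_b rmorphD fmorphV /= Du // /sq_minus_two.
by field.
Qed.

(** Restricted to the finite type [seq_sub r], the map is a permutation with inverse [iter n.-1 g],
    and all its orbits have [n] elements. *)
Lemma dvdn_size_of_cycles (T : choiceType) (f : T -> T) (r : seq T) (n : nat) :
    uniq r -> (0 < n)%N -> {in r, forall x, f x \in r} ->
    {in r, forall x, minimal_period f x n} ->
  (n %| size r)%N.
Proof.
move=> r_uniq n_gt0 fr per_r.
pose g (x : seq_sub r) : seq_sub r := SeqSub (fr _ (ssvalP x)).
have val_iter k x : ssval (iter k g x) = iter k f (ssval x).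
  by elim: k => //= k ->.
have iter_n x : iter n g x = x.
  by apply: val_inj; rewrite /= val_iter; have [] := per_r _ (ssvalP x).
have g_inj : injective g.
  apply: (@can_inj _ _ _ (iter n.-1 g)) => x.
  by rewrite -iterSr prednK.
have ord_g x : fingraph.order g x = n.
  have [_ _ min_n] := per_r _ (ssvalP x).
  apply/eqP; rewrite eqn_leq; apply/andP; split.
    (* Were [n] below the order, [iter n g x] would have index [n] in the orbit of [x]; but it is
       [x], of index 0. *)
    rewrite leqNgt; apply/negP => /findex_iter; rewrite iter_n findex0 => n_eq0.
    by rewrite -n_eq0 in n_gt0.
  apply: min_n; first exact: order_gt0.
  by rewrite -val_iter iter_order.
rewrite -(card_seq_sub r_uniq) -(@fcard_order_set _ g g_inj n [pred _ | true]).
- exact: dvdn_mull.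
- by apply/subsetP => x _; rewrite !inE ord_g.
- by [].
Qed.

Theorem theorem6 (K : fieldExtType rat) (D : nat) (hD : \dim {: K} = D)
    (alpha : K) (n : nat)
    (halpha : periodic_point (@sq_minus_two K) alpha)
    (hn : minimal_period (@sq_minus_two K) alpha n) :
  (n %| D)%N /\ iter D (@sq_minus_two K) alpha = alpha.
Proof.
have [n_gt0 alpha_n min_n] := hn.
suffices n_dv_D : (n %| D)%N.
  split=> //; have /dvdnP[m ->] := n_dv_D.
  by elim: m => [|m IHm] //; rewrite mulSn iterD IHm.
have /polyOver1P[q def_q] := minPolyOver 1%AS alpha.
have irr_q := irreducible_minPoly def_q.
have q_alpha : root (map_poly (in_alg K) q) alpha by rewrite -def_q root_minPoly.
pose ratrC : {rmorphism rat -> algC} := ratr.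
have [r def_r] := closed_field_poly_normal (map_poly ratrC q).
have q_neq0 : map_poly ratrC q != 0.
  by rewrite map_poly_eq0 irredp_neq0.
have lc_neq0 : lead_coef (map_poly ratrC q) != 0.
  by rewrite lead_coef_eq0.
have mem_r b : (b \in r) = root (map_poly ratrC q) b.
  by rewrite def_r rootZ // root_prod_XsubC.
have size_r : size r = \dim <<1; alpha>>.
  rewrite dim_Fadjoin dimv1 muln1; apply: succn_inj.
  rewrite -size_minPoly def_q size_map_poly -(size_map_poly ratrC).
  by rewrite def_r size_scale // size_prod_XsubC.
have r_uniq : uniq r.
  (* Separability is unaffected by base change, so it is checked in [K], of characteristic 0. *)
  rewrite -separable_prod_XsubC -(eqp_separable (eqp_scale _ lc_neq0)) -def_r.
  rewrite separable_map -(separable_map (in_alg K)) -def_q.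
  by apply: pcharf0_separable => p; rewrite pchar_lalg Num.Theory.pchar_num.
have per_r : {in r, forall b, minimal_period (@sq_minus_two algC) b n}.
  move=> b; rewrite mem_r => qb.
  split=> [//||m m_gt0 bm].
    by apply/(iter_sq_minus_two_root n irr_q q_alpha qb).
  by apply: min_n => //; apply/(iter_sq_minus_two_root m irr_q q_alpha qb).
have f_r : {in r, forall b, sq_minus_two b \in r}.
  move=> b r_b; have [_ bn _] := per_r b r_b.
  have [u <-] := periodic_sq_minus_two_aut n_gt0 bn.
  rewrite !mem_r in r_b *; rewrite /root.
  (* A ring morphism [u] fixes the rationals, hence sends roots of [q] to roots of [q]. *)
  have -> : map_poly ratrC q = map_poly u (map_poly ratrC q).
    by rewrite -map_poly_comp; apply: eq_map_poly => a /=; rewrite fmorph_rat.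
  by rewrite horner_map (rootP r_b) rmorph0.
have := dvdn_size_of_cycles r_uniq n_gt0 f_r per_r.
rewrite size_r -hD => /dvdn_trans; apply.
(* Tower law for the subfield generated by [alpha]. *)
exact/field_dimS/subvf.
Qed.
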